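(* There exist an absolute constant $C>0$ and $n_0$ such that for every $n\ge n_0$, every integer $t$ with $8\ln n\le t\le n^{1/3}$, and every integer $s$ with $1\le s\le \frac{t}{8\ln n}$, there exists a binary (over $\mathbb{F}_2$) $(s,t)$-batch code of dimension $n$ with redundancy at most $C\,t^{3/2}\sqrt{n}$. Consequently $r(n;s,t)\le C\,t^{3/2}\sqrt n$ in this range.
   Context: $[m]=\{1,\dots,m\}$. A linear code $\mathcal{C}\subseteq\mathbb{F}^N$ of dimension $n$ is systematic if for every $\mathbf{x}\in\mathbb{F}^n$ there is a unique codeword whose first $n$ coordinates equal $\mathbf{x}$. A set $R\subseteq[N]$ is a recovering set for $i\in[n]$ if there are scalars $\lambda_k$ with $\mathbf{c}(i)=\sum_{k\in R}\lambda_k\mathbf{c}(k)$ for all $\mathbf{c}\in\mathcal{C}$. $(s,t)$-batch code ($1\le s\le t$): a systematic linear code of dimension $n$ such that for every choice of indices $i_1,\dots,i_s\in[n]$ (not necessarily distinct) and nonnegative integers $a_1,\dots,a_s$ with $\sum_j a_j=t$, there exist $t$ pairwise disjoint sets $R_{j,l}\subseteq[N]$ ($j\in[s]$, $l\in[a_j]$), each a recovering set for $i_j$. Redundancy is $N-n$; $r(n;s,t)$ is the minimum redundancy of an $(s,t)$-batch code of dimension $n$ over all finite fields. *)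

(* Defs.v *)
From HB Require Import structures.
From mathcomp Require Import all_boot all_order all_algebra all_field.
Set Implicit Arguments. Unset Strict Implicit. Unset Printing Implicit Defensive.
Import GRing.Theory.
Local Open Scope ring_scope.

(* A linear code of length N = n + r over F is the row space of a matrix
   Cm : 'M[F]_(n + r); its codewords are the row vectors c with (c <= Cm)%MS.
   The first n coordinates are the "systematic" part (lsubmx c); the
   redundancy is N - n = r. *)

Definition codeword (F : fieldType) (n r : nat) (Cm : 'M[F]_(n + r))
  (c : 'rV[F]_(n + r)) : Prop := (c <= Cm)%MS.

Definition systematic (F : fieldType) (n r : nat) (Cm : 'M[F]_(n + r)) : Prop :=
  \rank Cm = n /\
  forall x : 'rV[F]_n, exists! c : 'rV[F]_(n + r), codeword Cm c /\ lsubmx c = x.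

Definition recovering_set (F : fieldType) (n r : nat) (Cm : 'M[F]_(n + r))
  (i : 'I_n) (R : {set 'I_(n + r)}) : Prop :=
  exists lam : 'I_(n + r) -> F,
    forall c : 'rV[F]_(n + r), codeword Cm c ->
      c 0 (lshift r i) = \sum_(k in R) lam k * c 0 k.

Definition batch_code (F : fieldType) (n r : nat) (Cm : 'M[F]_(n + r))
  (s t : nat) : Prop :=
  systematic Cm /\
  forall (idx : 'I_s -> 'I_n) (a : 'I_s -> nat),
    (\sum_(j < s) a j)%N = t ->
    exists Rs : 'I_s -> nat -> {set 'I_(n + r)},
      (forall (j : 'I_s) (l : nat), (l < a j)%N -> recovering_set Cm (idx j) (Rs j l)) /\
      (forall (j j' : 'I_s) (l l' : nat), (l < a j)%N -> (l' < a j')%N ->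
          (j, l) <> (j', l') -> [disjoint Rs j l & Rs j' l']).

(* Main.v *)
(** Colour the [n] coordinates independently with [m = 4 t] random colourings in
    [B ~ 8 sqrt (n t)] colours, and append one parity symbol per colour class, so
    that the redundancy is [m B = O(t^(3/2) sqrt n)].  A class containing [i],
    with [i] removed and its parity added, recovers [i].  The [t] requests are
    served greedily, the colourings being revealed one after the other: each
    colouring serves the first pending request [i] unless the other elements of
    the class of [i] number more than [L ~ B / (8 t)] or meet the set [U] of
    coordinates already used.  As [|U| <= t L <= B / 8] and a new colouring is independent of
    [U], each attempt fails with probability at most 1/4.  Hence a new colouring
    halves, on average, the sum of [4 ^ (number of pending requests)] over all
    request patterns.  There are at most [(n (t + 1)) ^ s < 4 ^ t] patterns, so the
    sum starts below [16 ^ t = 2 ^ m], and some choice of the [m] colourings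
    serves them all. *)

Require Import Defs.
From mathcomp Require Import all_boot all_order all_algebra all_field.
From mathcomp Require Import zify.
From Stdlib Require Import Reals Lra.
Set Implicit Arguments. Unset Strict Implicit. Unset Printing Implicit Defensive.
Import GRing.Theory.

(* Reals rebinds [^] on nat to Nat.pow. *)
Local Notation "m ^ n" := (expn m n) : nat_scope.

(** * Random colourings and greedy service of requests *)

Section Greedy.
Variables T K : finType.
Local Notation coloring := {ffun T -> K}.

Definition others (f : coloring) (i : T) : {set T} :=
  [set u | (u != i) && (f u == f i)].

(** Recolouring [u] arbitrarily loses nothing when [f u = f i]: the old colour of [u] is still
    visible at [i]. So a collision has probability at most [1 / #|K|]. *)
Lemma card_collision (u i : T) : u != i ->
  #|K| * #|[set f : coloring | f u == f i]| <= #|{: coloring}|.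
Proof.
move=> ui; rewrite -(cardsT K) mulnC -cardsX.
pose upd (p : coloring * K) : coloring := [ffun x => if x == u then p.2 else p.1 x].
have upd_inj : {in setX [set f : coloring | f u == f i] [set: K] &, injective upd}.
  move=> [f b] [g c]; rewrite !inE /= !andbT => /eqP fu /eqP gu /ffunP E.
  have fg x : x != u -> f x = g x.
    by move=> /negbTE xu; have := E x; rewrite !ffunE /= xu.
  congr pair; last by have := E u; rewrite !ffunE eqxx.
  apply/ffunP=> x; have [->|] := eqVneq x u; last exact: fg.
  by rewrite fu gu fg // eq_sym.
by rewrite -(card_in_imset upd_inj) max_card.
Qed.

Definition fits L (f : coloring) (U : {set T}) (i : T) : bool :=
  [disjoint others f i & U] && (#|others f i| <= L).

(** By linearity, [others f i] meets a fixed set [A] in at most [#|A| / #|K|] elements on average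
    ([count]). Markov's inequality with [A = U], then with [A] everything, bounds each cause of
    misfit by probability 1/8. *)
Lemma card_misfit L (U : {set T}) (i : T) :
  0 < #|K| -> 8 * #|U| <= #|K| -> 8 * #|T| <= #|K| * L.+1 ->
  4 * #|[set f : coloring | ~~ fits L f U i]| <= #|{: coloring}|.
Proof.
move=> K0 UK TK; set N := #|{: coloring}|.
pose meet := [set f : coloring | ~~ [disjoint others f i & U]].
pose large := [set f : coloring | L < #|others f i|].
have coll u : #|K| * (\sum_(f : coloring) (u \in others f i)) <= N.
  have [->|ui] := eqVneq u i.
    by rewrite big1 ?muln0 // => f _; rewrite inE eqxx.
  apply: leq_trans (card_collision ui); rewrite leq_mul2l -sum1dep_card [leqRHS]big_mkcond /=.
  by apply/orP; right; apply: leq_sum => f _; rewrite inE ui /=; case: eqP.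
have count (A : {set T}) : #|K| * (\sum_(f : coloring) #|A :&: others f i|) <= #|A| * N.
  rewrite -sum_nat_const.
  have -> : \sum_(f : coloring) #|A :&: others f i| =
            \sum_(u in A) \sum_(f : coloring) (u \in others f i).
    rewrite exchange_big /=; apply: eq_bigr => f _.
    rewrite -sum1_card big_mkcond [RHS]big_mkcond /=; apply: eq_bigr => u _.
    by rewrite inE; case: (u \in A); case: (u \in _).
  by rewrite big_distrr /=; apply: leq_sum => u _; apply: coll.
have meetK : #|K| * #|meet| <= #|U| * N.
  apply: leq_trans (count U); rewrite leq_mul2l -sum1_card big_mkcond /=.
  apply/orP; right; apply: leq_sum => f _; rewrite inE disjoint_sym -setI_eq0.
  by rewrite -card_gt0; case: posnP.
have largeK : #|K| * (L.+1 * #|large|) <= #|T| * N.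
  rewrite -(cardsT T); apply: leq_trans (count [set: T]).
  rewrite leq_mul2l -sum1_card big_distrr big_mkcond /=.
  apply/orP; right; apply: leq_sum => f _; rewrite inE setTI.
  by case: ltnP => // fL; rewrite muln1.
have sub : #|[set f : coloring | ~~ fits L f U i]| <= #|meet| + #|large|.
  have -> : [set f : coloring | ~~ fits L f U i] = meet :|: large.
    by apply/setP => f; rewrite !inE negb_and -ltnNge.
  by rewrite cardsU leq_subr.
have m8 : 8 * #|meet| <= N.
  rewrite -(leq_pmul2l K0); apply: leq_trans (_ : 8 * #|U| * N <= _).
    by rewrite -mulnA mulnCA leq_mul2l meetK orbT.
  by rewrite leq_mul2r UK orbT.
have l8 : 8 * #|large| <= N.
  have KL : 0 < #|K| * L.+1 by rewrite muln_gt0 K0.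
  rewrite -(leq_pmul2l KL); apply: leq_trans (_ : 8 * #|T| * N <= _).
    by rewrite mulnCA -!mulnA leq_mul2l largeK orbT.
  by rewrite leq_mul2r TK orbT.
by lia.
Qed.

(** The default [set0] lets disjointness in [served] be stated for all positions, without bounds. *)
Definition block (fs : seq coloring) (w : seq T) (D : nat -> nat) (p : nat) : {set T} :=
  if (onth fs (D p), onth w p) is (Some f, Some i) then others f i else set0.

(* Request number [p] of [w] is served by its class in the colouring number [D p]. *)
Definition served (fs : seq coloring) (U : {set T}) (w : seq T) : Prop :=
  exists D : nat -> nat,
    [/\ forall p, p < size w -> D p < size fs,
        forall p p', p < size w -> p' < size w -> D p = D p' -> p = p',
        forall p, [disjoint block fs w D p & U]
      & forall p p', p != p' -> [disjoint block fs w D p & block fs w D p']].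

Lemma served_nil fs U : served fs U [::].
Proof.
have b0 D p : block fs [::] D p = set0 by rewrite /block !onthE nth_nil; case: nth.
by exists (fun p => p); split=> // [p|p p' _]; rewrite !b0 disjoints_subset sub0set.
Qed.

Lemma served_skip f fs U w : served fs U w -> served (f :: fs) U w.
Proof.
move=> [D [Dlt Dinj DU DD]]; exists (fun p => (D p).+1); split=> //.
by move=> p p' pw pw' [/Dinj->].
Qed.

Lemma served_take f fs (U : {set T}) i w : [disjoint others f i & U] ->
  served fs (U :|: others f i) w -> served (f :: fs) U (i :: w).
Proof.
move=> fU [D [Dlt Dinj DU DD]].
have dU p : [disjoint block fs w D p & U].
  by rewrite disjoint_sym; apply: disjointWl (subsetUl _ (others f i)) _; rewrite disjoint_sym.
have df p : [disjoint block fs w D p & others f i].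
  by rewrite disjoint_sym; apply: disjointWl (subsetUr U _) _; rewrite disjoint_sym.
exists (fun p => if p is p'.+1 then (D p').+1 else 0); split.
- by case.
- by case=> [|p] [|p'] //= pw pw' [/Dinj->].
- by case=> [|p]; [exact: fU | exact: dU].
- case=> [|p] [|p'] //= pp'; [rewrite disjoint_sym; exact: df | exact: df | exact: DD].
Qed.

(* [0], not [4 ^ 0], on the empty list: a total below [1] then means that no
   request is pending. *)
Definition weight (w : seq T) : nat := if w is [::] then 0 else 4 ^ size w.

Definition step L (f : coloring) (c : {set T} * seq T) : {set T} * seq T :=
  if c.2 is i :: w then
    if fits L f c.1 i then (c.1 :|: others f i, w) else c
  else c.

Lemma weight_step L (c : {set T} * seq T) :
  0 < #|K| -> 8 * (#|c.1| + L * size c.2) <= #|K| -> 8 * #|T| <= #|K| * L.+1 ->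
  2 * (\sum_(f : coloring) weight (step L f c).2) <= #|{: coloring}| * weight c.2.
Proof.
case: c => U [|i w] /= K0 UK TK; first by rewrite big1 ?muln0.
have U8 : 8 * #|U| <= #|K| by apply: leq_trans UK; rewrite leq_mul2l leq_addr.
have := @card_misfit L U i K0 U8 TK.
set bad := [set f | _]; set N := #|{: coloring}|; move=> badN.
(* Success leaves weight at most [4 ^ size w], failure leaves four times that with probability at
   most 1/4: on average at most [2 * 4 ^ size w], half the old weight. *)
apply: (@leq_trans (2 * (\sum_(f : coloring) (4 ^ size w + (f \in bad) * 4 ^ (size w).+1)))).
  rewrite leq_mul2l /=; apply: leq_sum => f _; rewrite /step /= inE.
  case: ifP => _ /=; last by rewrite mul1n leq_addl.
  by rewrite addn0; case: w {UK}.
rewrite big_split /= sum_nat_const -big_distrl /=.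
have -> : \sum_(f : coloring) (f \in bad) = #|bad|.
  by rewrite -sum1_card [RHS]big_mkcond; apply: eq_bigr => f _; case: (f \in bad).
rewrite (_ : #|xpredT| = N) // expnS; move: (4 ^ _) => q.
have := leq_mul badN (leqnn q); nia.
Qed.

Lemma served_exists L (J : finType) (m : nat) (c : J -> {set T} * seq T) :
  0 < #|K| -> 8 * #|T| <= #|K| * L.+1 ->
  (forall j, 8 * (#|(c j).1| + L * size (c j).2) <= #|K|) ->
  \sum_j weight (c j).2 < 2 ^ m ->
  exists2 fs : seq coloring, size fs = m & forall j, served fs (c j).1 (c j).2.
Proof.
move=> K0 TK; elim: m c => [|m IHm] c cK.
  rewrite ltnS leqn0 sum_nat_eq0 => /forallP /= c0; exists [::] => // j.
  have := c0 j; case: (c j) => U [|i w] /= ; first by move=> _; exact: served_nil.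
  by rewrite expn_eq0.
move=> cm.
(* First moment: one colouring does at least as well as the average, for all patterns [j] at
   once. *)
have /existsP [f fP] : [exists f : coloring, \sum_j weight (step L f (c j)).2 < 2 ^ m].
  apply: contraLR cm => /existsPn fm; rewrite -leqNgt.
  have N0 : 0 < #|{: coloring}| by rewrite card_ffun expn_gt0 K0.
  rewrite -(leq_pmul2l N0) expnS mulnCA.
  apply: (@leq_trans (2 * (\sum_(f : coloring) \sum_j weight (step L f (c j)).2))).
    rewrite leq_mul2l /= -sum_nat_const; apply: leq_sum => f _; rewrite leqNgt; exact: fm.
  rewrite exchange_big /= !big_distrr /=; apply: leq_sum => j _; exact: weight_step.
have [j|fs szfs fsP] := IHm (fun j => step L f (c j)) _ fP.
  (* Invariant: a service adds at most [L] elements to [U] and removes one pending request. *)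
  have := cK j; rewrite /step; case: (c j) => U [|i w] //=.
  case: ifP => //= /andP [_ fL] cL; apply: leq_trans cL.
  rewrite leq_mul2l mulnS addnA leq_add2r (leq_trans (leq_card_setU _ _)) //.
  by rewrite leq_add2l.
exists (f :: fs) => /=; first by rewrite szfs.
move=> j; have := fsP j; rewrite /step; case: (c j) => U [|i w] /=.
  by move=> _; exact: served_nil.
case: ifP => /= [/andP [fU _]|_]; [exact: served_take | exact: served_skip].
Qed.

End Greedy.

(** * The systematic code of colour-class parities *)

Section ParityCode.
Local Open Scope ring_scope.

Lemma codeword_row_mx (F : fieldType) n r (P : 'M[F]_(n, r)) (c : 'rV[F]_(n + r)) :
  codeword <<row_mx 1%:M P>>%MS c <-> c = row_mx (lsubmx c) (lsubmx c *m P).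
Proof.
rewrite /codeword genmxE; split=> [/submxP [x ->]|->].
  by rewrite mul_mx_row mulmx1 row_mxKl.
by apply/submxP; exists (lsubmx c); rewrite mul_mx_row mulmx1.
Qed.

Lemma systematic_row_mx (F : fieldType) n r (P : 'M[F]_(n, r)) :
  systematic <<row_mx 1%:M P>>%MS.
Proof.
split=> [|x].
  rewrite mxrank_gen; apply/eqP; rewrite eqn_leq rank_leq_row /=.
  have := mxrankM_maxl (row_mx 1%:M P) (col_mx 1%:M 0 : 'M_(n + r, n)).
  by rewrite mul_row_col mulmx1 mulmx0 addr0 mxrank1.
exists (row_mx x (x *m P)); split.
  by split; [apply/codeword_row_mx; rewrite row_mxKl | rewrite row_mxKl].
by move=> c [/codeword_row_mx -> <-]; rewrite row_mxKl.
Qed.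

Variables (F : fieldType) (n m : nat) (K : finType) (g : 'I_m -> {ffun 'I_n -> K}).
Local Notation r := #|{: 'I_m * K}|.

Definition parity_mx : 'M[F]_(n, r) :=
  \matrix_(u, k) (g (enum_val k).1 u == (enum_val k).2)%:R.

Definition class_set (l : 'I_m) (i : 'I_n) : {set 'I_(n + r)} :=
  [set k | match fintype.split k with
           | inl u => u \in others (g l) i
           | inr k' => k' == enum_rank (l, g l i)
           end].

Lemma recovering_class_set l i :
  recovering_set <<row_mx 1%:M parity_mx>>%MS i (class_set l i).
Proof.
(* The symbol at [i] is the parity of its class minus the other members, whence coefficients 1 and
   -1. *)
exists (fun k => if fintype.split k is inl _ then -1 else 1) => c /codeword_row_mx ->.
move: (lsubmx c) => x; rewrite row_mxEl big_mkcond big_split_ord /=.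
under eq_bigr => u _ do rewrite inE (unsplitK (inl u)) row_mxEl mulN1r.
under [X in _ + X]eq_bigr => k _ do rewrite inE (unsplitK (inr k)) row_mxEr mul1r.
rewrite -!big_mkcond /= big_pred1_eq sumrN mxE.
under [X in _ + X]eq_bigr => u _ do rewrite mxE enum_rankK /=.
rewrite [X in _ + X](bigD1 i) //= eqxx mulr1 addrCA.
rewrite -[LHS]addr0; congr (_ + _); apply/esym/eqP; rewrite addrC subr_eq0; apply/eqP.
rewrite big_mkcond [RHS]big_mkcond /=; apply: eq_bigr => u _; rewrite inE.
by case: (u != i) => //=; case: (g l u == g l i); rewrite ?mulr1 ?mulr0.
Qed.

(** Different colourings use different parity symbols, so only the systematic parts could meet. *)
Lemma disjoint_class_set l l' i i' : l != l' ->
  [disjoint others (g l) i & others (g l') i'] ->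
  [disjoint class_set l i & class_set l' i'].
Proof.
move=> ll' dis; rewrite -setI_eq0; apply/eqP/setP => k; rewrite !inE.
case: (fintype.split k) => [u|k'].
  by apply/negP => /andP [u1 u2]; move/pred0P: dis => /(_ u) /=; rewrite u1 u2.
apply/negP => /andP [/eqP -> /eqP /enum_rank_inj [ll]]; by rewrite ll eqxx in ll'.
Qed.

End ParityCode.

(** * From colourings to batch codes *)

Lemma batch_code_exists (F : fieldType) (n m B s t L : nat) :
  0 < B -> 8 * (L * t) <= B -> 8 * n <= B * L.+1 ->
  (n * t.+1) ^ s * 4 ^ t < 2 ^ m ->
  exists (r : nat) (Cm : 'M[F]_(n + r)), r = m * B /\ batch_code Cm s t.
Proof.
move=> B0 LB nB few.
(* Multiplicities summing to [t] are at most [t], so the patterns form a finite type; those with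
   another sum get the empty request list. *)
pose J := {ffun 'I_s -> 'I_n * 'I_t.+1}.
pose reqs (a : 'I_s -> nat) : seq ('I_s * nat) :=
  [seq (j, l) | j <- enum 'I_s, l <- iota 0 (a j)].
pose w (c : J) : seq 'I_n :=
  if \sum_j (c j).2 == t then [seq (c x.1).1 | x <- reqs (fun j => (c j).2)] else [::].
have size_reqs a : size (reqs a) = \sum_j a j.
  rewrite size_allpairs_dep sumnE big_map big_enum /=.
  by apply: eq_bigr => j _; rewrite size_iota.
have szw c : size (w c) <= t.
  by rewrite /w; case: eqP => // ct; rewrite size_map size_reqs ct.
have ww c : weight (w c) <= 4 ^ t.
  by have := szw c; case: (w c) => // i v; rewrite /weight leq_exp2l.
have [||c||fs szfs fsP] := @served_exists 'I_n 'I_B L J m (fun c => (set0, w c)).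
- by rewrite card_ord.
- by rewrite !card_ord.
- by rewrite /= cards0 add0n card_ord (leq_trans _ LB) // !leq_mul2l szw !orbT.
- apply: leq_ltn_trans few; rewrite -[X in _ <= X ^ s * _](card_ord (n * t.+1)).
  apply: (@leq_trans (\sum_(c : J) 4 ^ t)); first by apply: leq_sum => c _; exact: ww.
  by rewrite sum_nat_const card_ffun card_prod !card_ord.
pose g (l : 'I_m) : {ffun 'I_n -> 'I_B} := tnth (Tuple (introT eqP szfs)) l.
exists #|{: 'I_m * 'I_B}|, <<row_mx 1%:M (parity_mx F g)>>%MS; split.
  by rewrite card_prod !card_ord.
split=> [|idx a at_]; first exact: systematic_row_mx.
pose c : J := [ffun j => (idx j, inord (a j))].
have ca j : (c j).2 = a j :> nat.
  rewrite ffunE /= inordK // ltnS -at_ (bigD1 j) //=; exact: leq_addr.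
have reqs_c : reqs (fun j => (c j).2) = reqs a.
  by rewrite /reqs; congr flatten; apply: eq_map => j; rewrite ca.
have wE : w c = [seq idx x.1 | x <- reqs a].
  rewrite /w reqs_c (eq_bigr a) => [|j _]; last exact: ca.
  by rewrite at_ eqxx; apply: eq_map => x; rewrite ffunE.
have := fsP c; rewrite /= wE => -[D [Dlt Dinj _ DD]].
rewrite size_map in Dlt Dinj.
have reqP j l : l < a j -> (j, l) \in reqs a.
  move=> la; apply/allpairsPdep; exists j, l.
  by rewrite mem_enum mem_iota add0n la.
pose pos j l := index (j, l) (reqs a).
have posP j l : l < a j -> pos j l < size (reqs a) by move=> /reqP; rewrite index_mem.
(* ['I_0] offers no default for [insubd]; with no colouring, [Dlt] excludes any request. *)
have [m0|m0] := posnP m.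
  exists (fun _ _ => set0); split=> [j l|j j' l l'] /posP /Dlt lt; exfalso;
    by rewrite szfs m0 in lt.
pose dir j l : 'I_m := insubd (Ordinal m0) (D (pos j l)).
have dirE j l : l < a j -> dir j l = D (pos j l) :> nat.
  by move=> /posP /Dlt Dm; rewrite insubdK // -szfs.
have blockE j l : l < a j ->
    block fs [seq idx x.1 | x <- reqs a] D (pos j l) = others (g (dir j l)) (idx j).
  move=> la; have pl := posP _ _ la; have dl := Dlt _ pl.
  rewrite /block !onthE (nth_map (g (dir j l))) // (nth_map (idx j)) ?size_map //.
  rewrite (nth_map (j, l)) // nth_index ?reqP //.
  by rewrite /g {2}(tnth_nth (g (dir j l))) /= dirE.
exists (fun j l => class_set g (dir j l) (idx j)); split.
  by move=> j l _; exact: recovering_class_set.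
move=> j j' l l' la la' jl.
have pp : pos j l != pos j' l'.
  apply/eqP => E; apply: jl.
  by rewrite -(nth_index (j, l) (reqP _ _ la)) -/(pos j l) E nth_index ?reqP.
apply: disjoint_class_set; last by rewrite -!blockE //; exact: DD.
apply/eqP => /(congr1 val); rewrite /= !dirE // => /Dinj E.
by rewrite E ?posP ?eqxx in pp.
Qed.

(** * Numerical estimates and choice of parameters *)

Open Scope R_scope.

Lemma requests_lt (n s t : nat) : (0 < t)%nat -> (t < n)%nat ->
  8 * INR s * ln (INR n) <= INR t -> ((n * t.+1) ^ s < 4 ^ t)%nat.
Proof.
move=> t0 tn st.
have n0 : 0 < INR n by apply: lt_0_INR; apply/ltP; lia.
have t0R : 1 <= INR t by apply: (le_INR 1); apply/leP.
have pow_nat a b : INR (a ^ b)%nat = INR a ^ b.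
  by elim: b => // b IHb; rewrite expnS mult_INR IHb.
(* As [t < n], the base is at most [n ^ 2]; then [n ^ (2 s) = exp (2 s ln n) <= exp t < 4 ^ t]. *)
apply: leq_ltn_trans (_ : ((n ^ 2) ^ s < _)%nat).
  by case: s {st} => // s; rewrite leq_exp2r // expnS expn1 leq_mul2l tn orbT.
rewrite -expnM; apply/ltP/INR_lt; rewrite !pow_nat.
have ne : INR n ^ (2 * s)%nat = exp (2 * INR s * ln (INR n)).
  rewrite -Rpower_pow // /Rpower; congr exp; congr (_ * _).
  by rewrite -(mult_INR 2).
rewrite ne; apply: Rle_lt_trans (_ : exp (INR t) < _).
  have [/exp_increasing|->] : 2 * INR s * ln (INR n) < INR t \/ 2 * INR s * ln (INR n) = INR t.
    by left; lra.
  - by move/Rlt_le.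
  - exact: Rle_refl.
have -> : exp (INR t) = Rpower (exp 1) (INR t) by rewrite /Rpower ln_exp Rmult_1_r.
have e4 : exp 1 < INR 4 by have := exp_le_3; rewrite /INR; lra.
have e0 := exp_pos 1.
rewrite -Rpower_pow; last by lra.
by apply: Rlt_Rpower_l; lra.
Qed.

Theorem theorem5 :
  exists C : R, 0 < C /\
  exists n0 : nat, forall n t s : nat,
    (n0 <= n)%nat ->
    8 * ln (INR n) <= INR t ->
    INR t <= Rpower (INR n) (1 / 3) ->
    (1 <= s)%nat ->
    INR s <= INR t / (8 * ln (INR n)) ->
    exists (r : nat) (Cm : 'M['F_2]_(n + r)),
      batch_code Cm s t /\
      INR r <= C * Rpower (INR t) (3 / 2) * sqrt (INR n).
Proof.
(* The redundancy is [4 t * 8 (floor (sqrt (n t)) + 1)], at most [64 t sqrt (n t)] since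
   [sqrt (n t) >= 1]. *)
exists 64; split; first lra.
(* [n >= 2] makes [ln n] positive and gives [t < n] when [t = 1]. *)
exists 2%nat => n t s n2 tn tn3 s1 st.
have n2R : 2 <= INR n by apply: (le_INR 2); apply/leP.
have ln0 : 0 < ln (INR n) by rewrite -ln_1; apply: ln_increasing; lra.
have t0 : (0 < t)%nat by apply/ltP/INR_lt; rewrite /=; lra.
have t0R : 0 < INR t by apply: lt_0_INR; apply/ltP.
have t3n : (t ^ 3 <= n)%nat.
  apply/leP/INR_le; rewrite !expnS expn0 muln1 !mult_INR.
  have -> : INR n = Rpower (INR n) (1 / 3) ^ 3.
    rewrite -Rpower_pow; last exact: exp_pos.
    rewrite Rpower_mult (_ : 1 / 3 * INR 3 = 1); last by rewrite /=; field.
    by rewrite Rpower_1; lra.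
  have -> : INR t * (INR t * INR t) = INR t ^ 3 by ring.
  by apply: pow_incr; split; [lra|].
have t_lt_n : (t < n)%nat.
  have [t1|] := leqP t 1; first by lia.
  by move=> t2; apply: leq_trans t3n; rewrite !expnS expn0 muln1; nia.
(* The successor makes [B ^ 2 >= 64 n t]; with [L = B %/ (8 t)], so [L + 1 > B / (8 t)], this yields
   [B (L + 1) >= 8 n]. *)
pose B := (8 * (Nat.sqrt (n * t)).+1)%nat.
have [sq_le sq_lt] := Nat.sqrt_spec (n * t) (Nat.le_0_l _).
have B2 : (64 * (n * t) <= B * B)%nat by rewrite /B; nia.
have [|||| r [Cm [rE CmP]]] :=
    @batch_code_exists 'F_2 n (4 * t) B s t (B %/ (8 * t)).
- by [].
- by rewrite mulnCA; exact: leq_trunc_div.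
- have tp : (0 < 8 * t)%nat by rewrite muln_gt0.
  have := ltn_ceil B tp; nia.
(* One factor [4 ^ t] of [2 ^ (4 t)] pays for the initial weight, the other for the number of
   patterns. *)
- rewrite (expnM 2 4 t) (_ : 2 ^ 4 = 4 * 4)%nat // (expnMn 4 4) ltn_pmul2r ?expn_gt0 //.
  apply: requests_lt => //.
  have : INR s * (8 * ln (INR n)) <= INR t / (8 * ln (INR n)) * (8 * ln (INR n)).
    by apply: Rmult_le_compat_r => //; lra.
  by rewrite /Rdiv Rmult_assoc Rinv_l ?Rmult_1_r; lra.
exists r, Cm; split=> //; rewrite rE.
have nt1 : 1 <= INR (n * t) by apply: (le_INR 1); apply/leP; rewrite muln_gt0 t0; lia.
have sqR : INR (Nat.sqrt (n * t)) <= sqrt (INR (n * t)).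
  rewrite -[X in X <= _](sqrt_square _ (pos_INR _)); apply: sqrt_le_1_alt.
  by rewrite -mult_INR; apply: le_INR.
have sq1 : 1 <= sqrt (INR (n * t)) by rewrite -sqrt_1; apply: sqrt_le_1_alt.
have -> : Rpower (INR t) (3 / 2) = INR t * sqrt (INR t).
  rewrite (_ : 3 / 2 = 1 + / 2); last by field.
  by rewrite Rpower_plus Rpower_1 // Rpower_sqrt.
rewrite !mult_INR (S_INR (Nat.sqrt _)).
have -> : 64 * (INR t * sqrt (INR t)) * sqrt (INR n) = 64 * (INR t * sqrt (INR (n * t))).
  by rewrite mult_INR sqrt_mult; [ring | lra | lra].
have -> : INR 4 = 4 by rewrite /=; ring.
have -> : INR 8 = 8 by rewrite /=; ring.
have := Rmult_le_compat_l (INR t) _ _ (Rlt_le _ _ t0R) sqR.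
have := Rmult_le_compat_l (INR t) _ _ (Rlt_le _ _ t0R) sq1.
lra.
Qed.
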